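(* Let $\mathcal{C}$ be a codifferential category with finite coproducts, and let $C$ be an object of $\mathcal{C}$. Then $d_{TC}:TC\to TC\otimes C$ is a universal $T$-derivation on the free $T$-algebra $(TC,\mu_C)$, where $TC\otimes C$ is the free $TC$-module on $C$ (with action $m\otimes 1_C$). That is, $d_{TC}$ is a $T$-derivation, and for every $TC$-module $M$ and every $T$-derivation $\partial:TC\to M$ there is a unique $TC$-linear map $\hat\partial:TC\otimes C\to M$ such that $d_{TC};\hat\partial=\partial$.
   Context: Composition is written in diagrammatic order: $f;g$ means first $f$, then $g$. Monoidal structures are written as if strict, with unit $k$ and symmetry $c$. An additive symmetric monoidal category is a symmetric monoidal category enriched over commutative monoids (hom-sets have addition and zero, composition is bilinear) whose tensor functor is additive in both variables. In such a category finite coproducts are biproducts, written $\oplus$, with projections $\pi_1,\pi_2$ and pairing $\langle f,g\rangle$. A commutative algebra is a commutative monoid object; modules are left modules, with action $\bullet_M:A\otimes M\to M$. An algebra modality on a symmetric monoidal category consists of a monad $(T,\mu,\eta)$ and, for each object $C$, morphisms $m:TC\otimes TC\to TC$, $e:k\to TC$ making $TC$ a commutative algebra, such that $m,e$ are natural in $C$ (each $Tf$ is an algebra homomorphism) and each $\mu_C:T^2C\to TC$ is an algebra homomorphism. A codifferential category is an additive symmetric monoidal category with an algebra modality $T$ and a deriving transform, i.e. a transformation $d_{TC}:TC\to TC\otimes C$, natural in $C$, such that: (d1) $e;d=0$; (d2) $m;d=(1\otimes d);(m\otimes 1)+(d\otimes 1);c;(m\otimes 1)$, where $c$ here is the symmetry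 $TC\otimes C\otimes TC\to TC\otimes TC\otimes C$; (d3) $\eta;d=e\otimes 1$; (d4) $\mu_C;d_{TC}=d_{T^2C};(\mu_C\otimes d_{TC});(m\otimes 1_C)$. Each $T$-algebra $(A,\nu)$ has an associated commutative algebra structure with multiplication $(\eta_A\otimes\eta_A);m;\nu$ and unit $e;\nu$; for $(TC,\mu_C)$ this is $(TC,m,e)$. An $A$-module is a module over the associated algebra. For a $T$-algebra $(A,\nu)$ and an $A$-module $M$, $W(A,M)$ is the $T$-algebra $(A\oplus M,\beta)$ with $\beta=\langle\beta_1,\beta_2\rangle:T(A\oplus M)\to A\oplus M$, $\beta_1=T\pi_1;\nu$ and $\beta_2=d_{T(A\oplus M)};(T\pi_1\otimes\pi_2);(\nu\otimes 1_M);\bullet_M$. A $T$-derivation is a morphism $\partial:A\to M$ in $\mathcal{C}$ such that $\langle 1_A,\partial\rangle:A\to A\oplus M$ is a $T$-algebra homomorphism $A\to W(A,M)$. *)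

(* Defs.v *)
From mathcomp Require Import ssreflect ssrfun.

Set Implicit Arguments.
Unset Strict Implicit.
Unset Printing Implicit Defensive.

Declare Scope cat_scope.
Delimit Scope cat_scope with cat.
Local Open Scope cat_scope.

Reserved Notation "A ~> B" (at level 90, no associativity).
Reserved Notation "f ;; g" (at level 50, left associativity).
Reserved Notation "A ⊗ B" (at level 40, left associativity).
Reserved Notation "f ⊠ g" (at level 40, left associativity).
Reserved Notation "f ⊞ g" (at level 55, left associativity).

(* Composition is diagrammatic: [f ;; g] is first [f], then [g].
   Hom-types carry Leibniz equality. *)
Record Category := {
  ob :> Type;
  hom : ob -> ob -> Type;
  idm : forall A, hom A A;
  comp : forall A B C, hom A B -> hom B C -> hom A C;
  comp1m : forall A B (f : hom A B), comp (idm A) f = f;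
  compm1 : forall A B (f : hom A B), comp f (idm B) = f;
  compA : forall A B C D (f : hom A B) (g : hom B C) (h : hom C D),
    comp f (comp g h) = comp (comp f g) h }.

Arguments hom {_} _ _.
Arguments idm {_} _.
Notation "A ~> B" := (hom A B) : cat_scope.
Notation "f ;; g" := (comp f g) : cat_scope.

(* The tensor product is [A ⊗ B] on objects and [f ⊠ g] on morphisms.
   Associators and unitors are explicit; the unit is [munit]. *)
Record SymMonCategory := {
  smc_cat :> Category;
  tens : smc_cat -> smc_cat -> smc_cat
    where "A ⊗ B" := (tens A B);
  munit : smc_cat;
  tensm : forall A A' B B' : smc_cat,
    (A ~> A') -> (B ~> B') -> (A ⊗ B ~> A' ⊗ B')
    where "f ⊠ g" := (tensm f g);
  asso : forall A B C : smc_cat, (A ⊗ B) ⊗ C ~> A ⊗ (B ⊗ C);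
  assoV : forall A B C : smc_cat, A ⊗ (B ⊗ C) ~> (A ⊗ B) ⊗ C;
  lunit : forall A : smc_cat, munit ⊗ A ~> A;
  lunitV : forall A : smc_cat, A ~> munit ⊗ A;
  runit : forall A : smc_cat, A ⊗ munit ~> A;
  runitV : forall A : smc_cat, A ~> A ⊗ munit;
  sym : forall A B : smc_cat, A ⊗ B ~> B ⊗ A;
  tens_id : forall A B : smc_cat, idm A ⊠ idm B = idm (A ⊗ B);
  tens_comp : forall (A1 A2 A3 B1 B2 B3 : smc_cat)
      (f : A1 ~> A2) (g : A2 ~> A3) (h : B1 ~> B2) (k : B2 ~> B3),
    (f ;; g) ⊠ (h ;; k) = (f ⊠ h) ;; (g ⊠ k);
  asso_nat : forall (A A' B B' C C' : smc_cat)
      (f : A ~> A') (g : B ~> B') (h : C ~> C'),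
    ((f ⊠ g) ⊠ h) ;; asso A' B' C' = asso A B C ;; (f ⊠ (g ⊠ h));
  assoK : forall A B C : smc_cat, asso A B C ;; assoV A B C = idm _;
  assoVK : forall A B C : smc_cat, assoV A B C ;; asso A B C = idm _;
  lunit_nat : forall (A B : smc_cat) (f : A ~> B),
    (idm munit ⊠ f) ;; lunit B = lunit A ;; f;
  lunitK : forall A : smc_cat, lunit A ;; lunitV A = idm _;
  lunitVK : forall A : smc_cat, lunitV A ;; lunit A = idm _;
  runit_nat : forall (A B : smc_cat) (f : A ~> B),
    (f ⊠ idm munit) ;; runit B = runit A ;; f;
  runitK : forall A : smc_cat, runit A ;; runitV A = idm _;
  runitVK : forall A : smc_cat, runitV A ;; runit A = idm _;
  pentagon : forall A B C D : smc_cat,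
    asso (A ⊗ B) C D ;; asso A B (C ⊗ D)
    = (asso A B C ⊠ idm D) ;; asso A (B ⊗ C) D ;; (idm A ⊠ asso B C D);
  triangle : forall A B : smc_cat,
    asso A munit B ;; (idm A ⊠ lunit B) = runit A ⊠ idm B;
  sym_nat : forall (A A' B B' : smc_cat) (f : A ~> A') (g : B ~> B'),
    (f ⊠ g) ;; sym A' B' = sym A B ;; (g ⊠ f);
  symK : forall A B : smc_cat, sym A B ;; sym B A = idm _;
  hexagon : forall A B C : smc_cat,
    asso A B C ;; sym A (B ⊗ C) ;; asso B C A
    = (sym A B ⊠ idm C) ;; asso B A C ;; (idm B ⊠ sym A C) }.

Arguments munit {_}.
Notation "A ⊗ B" := (tens A B) : cat_scope.
Notation "f ⊠ g" := (tensm f g) : cat_scope.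

Record AddSymMonCategory := {
  asmc_smc :> SymMonCategory;
  hadd : forall A B : asmc_smc, (A ~> B) -> (A ~> B) -> (A ~> B)
    where "f ⊞ g" := (hadd f g);
  hzero : forall A B : asmc_smc, A ~> B;
  haddA : forall (A B : asmc_smc) (f g h : A ~> B),
    f ⊞ (g ⊞ h) = (f ⊞ g) ⊞ h;
  haddC : forall (A B : asmc_smc) (f g : A ~> B), f ⊞ g = g ⊞ f;
  hadd0 : forall (A B : asmc_smc) (f : A ~> B), hzero A B ⊞ f = f;
  compDl : forall (A B C : asmc_smc) (f g : A ~> B) (h : B ~> C),
    (f ⊞ g) ;; h = (f ;; h) ⊞ (g ;; h);
  compDr : forall (A B C : asmc_smc) (f : A ~> B) (g h : B ~> C),
    f ;; (g ⊞ h) = (f ;; g) ⊞ (f ;; h);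
  comp0l : forall (A B C : asmc_smc) (f : B ~> C),
    hzero A B ;; f = hzero A C;
  comp0r : forall (A B C : asmc_smc) (f : A ~> B),
    f ;; hzero B C = hzero A C;
  tensDl : forall (A A' B B' : asmc_smc) (f g : A ~> A') (h : B ~> B'),
    (f ⊞ g) ⊠ h = (f ⊠ h) ⊞ (g ⊠ h);
  tensDr : forall (A A' B B' : asmc_smc) (f : A ~> A') (g h : B ~> B'),
    f ⊠ (g ⊞ h) = (f ⊠ g) ⊞ (f ⊠ h);
  tens0l : forall (A A' B B' : asmc_smc) (h : B ~> B'),
    hzero A A' ⊠ h = hzero (A ⊗ B) (A' ⊗ B');
  tens0r : forall (A A' B B' : asmc_smc) (f : A ~> A'),
    f ⊠ hzero B B' = hzero (A ⊗ B) (A' ⊗ B') }.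

Notation "f ⊞ g" := (hadd f g) : cat_scope.

Record FiniteCoproducts (C : Category) := {
  initial : C;
  from_initial : forall A : C, initial ~> A;
  from_initial_uniq : forall (A : C) (f : initial ~> A), f = from_initial A;
  cop : C -> C -> C;
  inj1 : forall A B : C, A ~> cop A B;
  inj2 : forall A B : C, B ~> cop A B;
  copair : forall A B D : C, (A ~> D) -> (B ~> D) -> (cop A B ~> D);
  inj1_copair : forall (A B D : C) (f : A ~> D) (g : B ~> D),
    inj1 A B ;; copair f g = f;
  inj2_copair : forall (A B D : C) (f : A ~> D) (g : B ~> D),
    inj2 A B ;; copair f g = g;
  copair_uniq : forall (A B D : C) (h : cop A B ~> D),
    h = copair (inj1 A B ;; h) (inj2 A B ;; h) }.

(* In an additive category binary coproducts are biproducts; the projections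
   and the pairing are determined by the coproduct structure. *)
Definition proj1b (C : AddSymMonCategory) (cp : FiniteCoproducts C) (A B : C) :
  cop cp A B ~> A := copair cp (idm A) (hzero B A).

Definition proj2b (C : AddSymMonCategory) (cp : FiniteCoproducts C) (A B : C) :
  cop cp A B ~> B := copair cp (hzero A B) (idm B).

Definition pairb (C : AddSymMonCategory) (cp : FiniteCoproducts C) (A B D : C)
  (f : D ~> A) (g : D ~> B) : D ~> cop cp A B :=
  (f ;; inj1 cp A B) ⊞ (g ;; inj2 cp A B).

Lemma haddr0 (C : AddSymMonCategory) (A B : C) (f : A ~> B) :
  f ⊞ hzero A B = f.
Proof. by rewrite haddC hadd0. Qed.

Lemma copair_eq (C : Category) (cp : FiniteCoproducts C) (A B D : C)
  (f g : cop cp A B ~> D) :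
  inj1 cp A B ;; f = inj1 cp A B ;; g ->
  inj2 cp A B ;; f = inj2 cp A B ;; g -> f = g.
Proof. by move=> e1 e2; rewrite (copair_uniq f) (copair_uniq g) e1 e2. Qed.

Lemma pair_proj1 (C : AddSymMonCategory) (cp : FiniteCoproducts C) (A B D : C)
  (f : D ~> A) (g : D ~> B) : pairb cp f g ;; proj1b cp A B = f.
Proof.
rewrite /pairb /proj1b compDl -!compA inj1_copair inj2_copair.
by rewrite compm1 comp0r haddr0.
Qed.

Lemma pair_proj2 (C : AddSymMonCategory) (cp : FiniteCoproducts C) (A B D : C)
  (f : D ~> A) (g : D ~> B) : pairb cp f g ;; proj2b cp A B = g.
Proof.
rewrite /pairb /proj2b compDl -!compA inj1_copair inj2_copair.
by rewrite compm1 comp0r hadd0.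
Qed.

Lemma pair_uniq (C : AddSymMonCategory) (cp : FiniteCoproducts C) (A B D : C)
  (h : D ~> cop cp A B) :
  h = pairb cp (h ;; proj1b cp A B) (h ;; proj2b cp A B).
Proof.
rewrite /pairb -!compA -compDr -[LHS]compm1; congr (_ ;; _).
apply: copair_eq; rewrite compDr !compA.
- by rewrite inj1_copair inj1_copair comp1m comp0l haddr0 compm1.
- by rewrite inj2_copair inj2_copair comp1m comp0l hadd0 compm1.
Qed.

Lemma pair_eq (C : AddSymMonCategory) (cp : FiniteCoproducts C) (A B D : C)
  (f g : D ~> cop cp A B) :
  f ;; proj1b cp A B = g ;; proj1b cp A B ->
  f ;; proj2b cp A B = g ;; proj2b cp A B -> f = g.
Proof. by move=> e1 e2; rewrite (pair_uniq f) (pair_uniq g) e1 e2. Qed.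

Record is_comm_algebra (C : SymMonCategory) (A : C)
    (m : A ⊗ A ~> A) (e : munit ~> A) : Prop := {
  algA : asso A A A ;; (idm A ⊠ m) ;; m = (m ⊠ idm A) ;; m;
  alg1l : (e ⊠ idm A) ;; m = lunit A;
  alg1r : (idm A ⊠ e) ;; m = runit A;
  algC : sym A A ;; m = m }.

Record CommAlgebra (C : SymMonCategory) := {
  alg_ob :> C;
  alg_mul : alg_ob ⊗ alg_ob ~> alg_ob;
  alg_unit : munit ~> alg_ob;
  alg_laws : is_comm_algebra alg_mul alg_unit }.

Definition is_alg_hom (C : SymMonCategory) (A B : C)
    (mA : A ⊗ A ~> A) (eA : munit ~> A) (mB : B ⊗ B ~> B) (eB : munit ~> B)
    (f : A ~> B) : Prop :=
  mA ;; f = (f ⊠ f) ;; mB /\ eA ;; f = eB.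

Record Module (C : SymMonCategory) (A : CommAlgebra C) := {
  mod_ob :> C;
  act : A ⊗ mod_ob ~> mod_ob;
  actA : asso A A mod_ob ;; (idm A ⊠ act) ;; act
         = (alg_mul A ⊠ idm mod_ob) ;; act;
  act1 : (alg_unit A ⊠ idm mod_ob) ;; act = lunit mod_ob }.

Definition is_linear (C : SymMonCategory) (A : CommAlgebra C)
    (M N : Module A) (f : M ~> N) : Prop :=
  act M ;; f = (idm A ⊠ f) ;; act N.

Record Monad (C : Category) := {
  mon_ob :> C -> C;
  mon_map : forall A B : C, (A ~> B) -> (mon_ob A ~> mon_ob B);
  eta : forall A : C, A ~> mon_ob A;
  mu : forall A : C, mon_ob (mon_ob A) ~> mon_ob A;
  mon_id : forall A : C, mon_map (idm A) = idm (mon_ob A);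
  mon_comp : forall (A B D : C) (f : A ~> B) (g : B ~> D),
    mon_map (f ;; g) = mon_map f ;; mon_map g;
  eta_nat : forall (A B : C) (f : A ~> B), eta A ;; mon_map f = f ;; eta B;
  mu_nat : forall (A B : C) (f : A ~> B),
    mon_map (mon_map f) ;; mu B = mu A ;; mon_map f;
  eta_mu : forall A : C, eta (mon_ob A) ;; mu A = idm (mon_ob A);
  map_eta_mu : forall A : C, mon_map (eta A) ;; mu A = idm (mon_ob A);
  mu_mu : forall A : C, mon_map (mu A) ;; mu A = mu (mon_ob A) ;; mu A }.

Record AlgebraModality (C : SymMonCategory) := {
  modality_monad :> Monad C;
  mmul : forall A : C,
    modality_monad A ⊗ modality_monad A ~> modality_monad A;
  mone : forall A : C, munit ~> modality_monad A;
  modality_alg : forall A : C, is_comm_algebra (mmul A) (mone A);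
  modality_nat : forall (A B : C) (f : A ~> B),
    is_alg_hom (mmul A) (mone A) (mmul B) (mone B)
      (mon_map modality_monad f);
  modality_mu : forall A : C,
    is_alg_hom (mmul (modality_monad A)) (mone (modality_monad A))
      (mmul A) (mone A) (mu modality_monad A) }.

Record TAlgebra (C : SymMonCategory) (T : AlgebraModality C) := {
  talg_ob :> C;
  nu : T talg_ob ~> talg_ob;
  eta_nu : eta T talg_ob ;; nu = idm talg_ob;
  mu_nu : mu T talg_ob ;; nu = mon_map T nu ;; nu }.

Definition is_talg_hom (C : SymMonCategory) (T : AlgebraModality C)
    (A B : TAlgebra T) (f : A ~> B) : Prop :=
  nu A ;; f = mon_map T f ;; nu B.

Definition free_talg (C : SymMonCategory) (T : AlgebraModality C) (X : C) :
  TAlgebra T :=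
  {| talg_ob := T X; nu := mu T X; eta_nu := eta_mu T X;
     mu_nu := esym (mu_mu T X) |}.

Definition assoc_mul (C : SymMonCategory) (T : AlgebraModality C)
    (A : TAlgebra T) : A ⊗ A ~> A :=
  (eta T A ⊠ eta T A) ;; mmul T A ;; nu A.

Definition assoc_unit (C : SymMonCategory) (T : AlgebraModality C)
    (A : TAlgebra T) : munit ~> A := mone T A ;; nu A.

Lemma mmul_nu (C : SymMonCategory) (T : AlgebraModality C) (A : TAlgebra T) :
  mmul T A ;; nu A = (nu A ⊠ nu A) ;; assoc_mul A.
Proof.
rewrite /assoc_mul !compA -tens_comp -eta_nat tens_comp.
rewrite -(compA _ (mon_map T _ ⊠ _)) -(proj1 (modality_nat T (nu A))).
rewrite -!compA -mu_nu (compA (mmul T (T A))).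
by rewrite (proj1 (modality_mu T A)) !compA -tens_comp eta_mu tens_id comp1m.
Qed.

Lemma assoc_alg_laws (C : SymMonCategory) (T : AlgebraModality C)
  (A : TAlgebra T) : is_comm_algebra (assoc_mul A) (assoc_unit A).
Proof.
have [mA m1l m1r mC] := modality_alg T A.
have e1 : idm A = eta T A ;; nu A by rewrite eta_nu.
have mE (X Y : C) (f : X ~> T A) (g : Y ~> T A) :
    ((f ;; nu A) ⊠ (g ;; nu A)) ;; assoc_mul A = (f ⊠ g) ;; mmul T A ;; nu A.
  by rewrite tens_comp -compA -mmul_nu compA.
have aE : assoc_mul A = (eta T A ⊠ eta T A) ;; mmul T A ;; nu A by [].
split.
- rewrite [X in idm A ⊠ X]aE [X in X ⊠ idm A]aE e1 -compA !mE.
  have -> : eta T A ⊠ ((eta T A ⊠ eta T A) ;; mmul T A)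
            = (eta T A ⊠ (eta T A ⊠ eta T A)) ;; (idm (T A) ⊠ mmul T A).
    by rewrite -tens_comp compm1.
  have -> : ((eta T A ⊠ eta T A) ;; mmul T A) ⊠ eta T A
            = ((eta T A ⊠ eta T A) ⊠ eta T A) ;; (mmul T A ⊠ idm (T A)).
    by rewrite -tens_comp compm1.
  rewrite !compA -asso_nat -(compA _ (asso _ _ _)) -(compA _ (asso _ _ _ ;; _)).
  by rewrite mA !compA.
- rewrite e1 mE -[mone T A]comp1m -[eta T A]compm1 tens_comp.
  by rewrite -(compA _ _ (mmul T A)) m1l lunit_nat -compA eta_nu compm1.
- rewrite e1 mE -[mone T A]comp1m -[eta T A]compm1 tens_comp.
  by rewrite -(compA _ _ (mmul T A)) m1r runit_nat -compA eta_nu compm1.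
- by rewrite aE !compA -sym_nat -(compA _ (sym _ _)) mC.
Qed.

Definition assoc_alg (C : SymMonCategory) (T : AlgebraModality C)
  (A : TAlgebra T) : CommAlgebra C :=
  {| alg_ob := A; alg_mul := assoc_mul A; alg_unit := assoc_unit A;
     alg_laws := assoc_alg_laws A |}.

Lemma free_assoc_mul (C : SymMonCategory) (T : AlgebraModality C) (X : C) :
  assoc_mul (free_talg T X) = mmul T X.
Proof.
rewrite /assoc_mul /= -compA (proj1 (modality_mu T X)) compA -tens_comp.
by rewrite eta_mu tens_id comp1m.
Qed.

Lemma free_assoc_unit (C : SymMonCategory) (T : AlgebraModality C) (X : C) :
  assoc_unit (free_talg T X) = mone T X.
Proof. exact: (proj2 (modality_mu T X)). Qed.

Lemma assoV_nat (C : SymMonCategory) (A A' B B' D D' : C)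
  (f : A ~> A') (g : B ~> B') (h : D ~> D') :
  (f ⊠ (g ⊠ h)) ;; assoV A' B' D' = assoV A B D ;; ((f ⊠ g) ⊠ h).
Proof.
rewrite -[LHS]comp1m -assoVK -!compA (compA (asso _ _ _)) -asso_nat.
by rewrite -!compA assoK compm1.
Qed.

(* Kelly's coherence lemma, which is not among the axioms above. *)
Lemma lunit_tens (C : SymMonCategory) (A B : C) :
  asso munit A B ;; lunit (A ⊗ B) = lunit A ⊠ idm B.
Proof.
have cancel_iso (D E P : C) (u : E ~> D) (v : D ~> E) (f g : E ~> P) :
    u ;; v = idm E -> v ;; f = v ;; g -> f = g.
  by move=> uv vfg; rewrite -[f]comp1m -[g]comp1m -uv -!compA vfg.
have tensI (D E : C) (f g : D ~> E) :
    @idm C munit ⊠ f = @idm C munit ⊠ g -> f = g.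
  move=> fg; apply: (cancel_iso _ _ _ _ _ _ _ (lunitVK D)).
  by rewrite -!lunit_nat fg.
apply: tensI.
apply: (cancel_iso _ _ _ _ _ _ _ (assoVK munit (munit ⊗ A) B)).
apply: (cancel_iso _ _ _ (assoV munit munit A ⊠ idm B)
                         (asso munit munit A ⊠ idm B)).
  by rewrite -tens_comp assoVK comp1m tens_id.
rewrite -{1}[idm munit]comp1m tens_comp !compA -pentagon.
rewrite -compA triangle -tens_id -asso_nat -triangle.
by rewrite -compA -asso_nat compA -tens_comp comp1m.
Qed.

Definition free_act (C : SymMonCategory) (T : AlgebraModality C) (X : C) :
  T X ⊗ (T X ⊗ X) ~> T X ⊗ X :=
  assoV (T X) (T X) X ;; (mmul T X ⊠ idm X).


Lemma free_actA (C : SymMonCategory) (T : AlgebraModality C) (X : C) :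
  asso (T X) (T X) (T X ⊗ X) ;; (idm (T X) ⊠ free_act T X) ;; free_act T X
  = (alg_mul (assoc_alg (free_talg T X)) ⊠ idm (T X ⊗ X)) ;; free_act T X.
Proof.
have pV : asso (T X) (T X) (T X ⊗ X) ;; (idm (T X) ⊠ assoV (T X) (T X) X)
          ;; assoV (T X) (T X ⊗ T X) X
          = assoV (T X ⊗ T X) (T X) X ;; (asso (T X) (T X) (T X) ⊠ idm X).
  rewrite -[LHS]comp1m -(assoVK (T X ⊗ T X)) -!compA; congr (_ ;; _).
  rewrite !compA pentagon -!compA (compA (idm _ ⊠ _)) -tens_comp.
  by rewrite assoK comp1m tens_id comp1m assoK compm1.
rewrite /= free_assoc_mul /free_act -tens_id [RHS]compA assoV_nat.
rewrite -{1}[idm (T X)]comp1m tens_comp !compA.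
rewrite -(compA _ (idm _ ⊠ (_ ⊠ _))) assoV_nat !compA pV -!compA.
rewrite -!tens_comp !compm1 compA (algA (modality_alg T X)).
by [].
Qed.

Lemma free_act1 (C : SymMonCategory) (T : AlgebraModality C) (X : C) :
  (alg_unit (assoc_alg (free_talg T X)) ⊠ idm (T X ⊗ X)) ;; free_act T X
  = lunit (T X ⊗ X).
Proof.
rewrite /= free_assoc_unit /free_act -tens_id compA assoV_nat -compA.
rewrite -tens_comp comp1m (alg1l (modality_alg T X)) -lunit_tens compA.
by rewrite assoVK comp1m.
Qed.

Definition free_module (C : SymMonCategory) (T : AlgebraModality C) (X : C) :
  Module (assoc_alg (free_talg T X)) :=
  @Build_Module C (assoc_alg (free_talg T X)) (T X ⊗ X) (free_act T X)
    (free_actA T X) (free_act1 T X).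

Lemma sym_mmul (C : SymMonCategory) (T : AlgebraModality C) (X : C) :
  sym (T X ⊗ X) (T X) ;; assoV (T X) (T X) X ;; (mmul T X ⊠ idm X)
  = asso (T X) X (T X) ;; (idm (T X) ⊠ sym X (T X)) ;; assoV (T X) (T X) X
    ;; (mmul T X ⊠ idm X).
Proof.
set A := T X; set r := asso A X A ;; (idm A ⊠ sym X A) ;; assoV A A X.
have rK : r ;; (sym A A ⊠ idm X) ;; asso A A X ;; sym A (A ⊗ X) = idm _.
  rewrite -[LHS]compm1 -(assoK A X A) compA -(compA _ (asso A A X)).
  rewrite -(compA _ _ (asso A X A)) hexagon !compA.
  rewrite -(compA r) -tens_comp symK comp1m tens_id compm1 /r.
  rewrite -(compA _ (assoV A A X)) assoVK compm1.
  by rewrite -(compA _ (idm A ⊠ _) (idm A ⊠ _)) -tens_comp symK comp1m tens_id compm1.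
have -> : sym (A ⊗ X) A ;; assoV A A X = r ;; (sym A A ⊠ idm X).
  rewrite -[LHS]comp1m -rK !compA -(compA _ (sym A _)) symK compm1.
  by rewrite -(compA _ (asso A A X)) assoK compm1.
rewrite -compA -tens_comp comp1m.
by rewrite (algC (modality_alg T X)).
Qed.

Record DerivingTransform (C : AddSymMonCategory) (T : AlgebraModality C) := {
  deriv :> forall X : C, T X ~> T X ⊗ X;
  deriv_nat : forall (X Y : C) (f : X ~> Y),
    deriv X ;; (mon_map T f ⊠ f) = mon_map T f ;; deriv Y;
  deriv_const : forall X : C,
    mone T X ;; deriv X = hzero munit (T X ⊗ X);
  (* [sym] moves the right-hand factor [T X] in front of [T X ⊗ X]; by
     commutativity of [mmul], moving it only past [X] gives the same law,
     see [sym_mmul]. *)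
  deriv_mul : forall X : C,
    mmul T X ;; deriv X
    = ((idm (T X) ⊠ deriv X) ;; assoV (T X) (T X) X ;; (mmul T X ⊠ idm X))
      ⊞ ((deriv X ⊠ idm (T X)) ;; sym (T X ⊗ X) (T X)
         ;; assoV (T X) (T X) X ;; (mmul T X ⊠ idm X));
  deriv_eta : forall X : C,
    eta T X ;; deriv X = lunitV X ;; (mone T X ⊠ idm X);
  deriv_mu : forall X : C,
    mu T X ;; deriv X
    = deriv (T X) ;; (mu T X ⊠ deriv X)
      ;; assoV (T X) (T X) X ;; (mmul T X ⊠ idm X) }.

Record CodifferentialCategory := {
  codiff_cat :> AddSymMonCategory;
  codiff_T : AlgebraModality codiff_cat;
  codiff_d : DerivingTransform codiff_T }.

Arguments codiff_T {_}.
Arguments codiff_d {_}.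
Notation "'𝐓'" := codiff_T : cat_scope.
Notation "'𝐝'" := codiff_d : cat_scope.

Definition W_beta1 (C : CodifferentialCategory) (cp : FiniteCoproducts C)
    (A : TAlgebra (@codiff_T C)) (M : Module (assoc_alg A)) :
  𝐓 (cop cp A M) ~> A :=
  mon_map 𝐓 (proj1b cp A M) ;; nu A.

Definition W_beta2 (C : CodifferentialCategory) (cp : FiniteCoproducts C)
    (A : TAlgebra (@codiff_T C)) (M : Module (assoc_alg A)) :
  𝐓 (cop cp A M) ~> M :=
  𝐝 (cop cp A M) ;; (mon_map 𝐓 (proj1b cp A M) ⊠ proj2b cp A M)
  ;; (nu A ⊠ idm M) ;; act M.

Definition W_beta (C : CodifferentialCategory) (cp : FiniteCoproducts C)
    (A : TAlgebra (@codiff_T C)) (M : Module (assoc_alg A)) :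
  𝐓 (cop cp A M) ~> cop cp A M :=
  pairb cp (W_beta1 cp M) (W_beta2 cp M).

Lemma W_beta2E (C : CodifferentialCategory) (cp : FiniteCoproducts C)
    (A : TAlgebra (@codiff_T C)) (M : Module (assoc_alg A)) :
  W_beta2 cp M
  = 𝐝 (cop cp A M) ;; (W_beta1 cp M ⊠ proj2b cp A M) ;; act M.
Proof.
by rewrite /W_beta2 -(compA _ _ (nu A ⊠ _)) -tens_comp compm1.
Qed.

Lemma W_eta (C : CodifferentialCategory) (cp : FiniteCoproducts C)
    (A : TAlgebra (@codiff_T C)) (M : Module (assoc_alg A)) :
  eta 𝐓 (cop cp A M) ;; W_beta cp M = idm (cop cp A M).
Proof.
apply: pair_eq; rewrite -compA /W_beta.
- by rewrite pair_proj1 /W_beta1 compA eta_nat -compA eta_nu comp1m compm1.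
- rewrite pair_proj2 W_beta2E !compA deriv_eta -(compA (lunitV _)).
  rewrite -tens_comp comp1m /W_beta1 compA.
  rewrite (proj2 (modality_nat 𝐓 (proj1b cp A M))).
  rewrite -[proj2b _ _ _]compm1 -[_ ;; nu A]comp1m tens_comp -!compA.
  have -> : ((mone 𝐓 A ;; nu A) ⊠ idm M) ;; act M = lunit M by exact: act1.
  by rewrite lunit_nat compA lunitVK comp1m compm1.
Qed.

Lemma W_mu (C : CodifferentialCategory) (cp : FiniteCoproducts C)
    (A : TAlgebra (@codiff_T C)) (M : Module (assoc_alg A)) :
  mu 𝐓 (cop cp A M) ;; W_beta cp M
  = mon_map 𝐓 (W_beta cp M) ;; W_beta cp M.
Proof.
set P := cop cp A M.
have b1 : mu 𝐓 P ;; W_beta1 cp M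
          = mon_map 𝐓 (W_beta1 cp M) ;; nu A.
  by rewrite /W_beta1 compA -mu_nat -compA mu_nu compA -mon_comp.
have b1m : mmul 𝐓 P ;; W_beta1 cp M
           = (W_beta1 cp M ⊠ W_beta1 cp M) ;; assoc_mul A.
  rewrite /W_beta1 compA (proj1 (modality_nat 𝐓 (proj1b cp A M))) -compA.
  by rewrite mmul_nu compA -tens_comp.
have b2 : mon_map 𝐓 (W_beta cp M) ;; W_beta1 cp M = mu 𝐓 P ;; W_beta1 cp M.
  by rewrite b1 {2}/W_beta1 compA -mon_comp pair_proj1.
have actV : (idm A ⊠ act M) ;; act M
            = assoV A A M ;; (assoc_mul A ⊠ idm M) ;; act M.
  have /= aM := actA M.
  by rewrite -(compA (assoV _ _ _)) -aM !compA assoVK comp1m.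
apply: pair_eq; rewrite -!compA; first by rewrite pair_proj1 b2.
rewrite pair_proj2 W_beta2E.
transitivity (𝐝 (𝐓 P) ;; ((mu 𝐓 P ;; W_beta1 cp M) ⊠ W_beta2 cp M)
              ;; act M); last first.
  have -> : (mu 𝐓 P ;; W_beta1 cp M) ⊠ W_beta2 cp M
            = (mon_map 𝐓 (W_beta cp M) ⊠ W_beta cp M)
              ;; (W_beta1 cp M ⊠ proj2b cp A M).
    by rewrite -tens_comp b2 pair_proj2.
  by rewrite !compA deriv_nat.
have -> : (mu 𝐓 P ;; W_beta1 cp M) ⊠ W_beta2 cp M
          = (mu 𝐓 P ⊠ 𝐝 P) ;; (W_beta1 cp M ⊠ (W_beta1 cp M ⊠ proj2b cp A M))
            ;; (idm A ⊠ act M).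
  by rewrite -!tens_comp compm1 W_beta2E.
rewrite -!compA actV !compA deriv_mu -(compA _ _ (assoV A A M)) assoV_nat.
rewrite -(compA _ (mmul 𝐓 P ⊠ idm P)) -tens_comp comp1m b1m.
by rewrite -[proj2b cp A M in LHS]compm1 tens_comp !compA.
Qed.

Definition W (C : CodifferentialCategory) (cp : FiniteCoproducts C)
    (A : TAlgebra (@codiff_T C)) (M : Module (assoc_alg A)) :
  TAlgebra (@codiff_T C) :=
  {| talg_ob := cop cp A M; nu := W_beta cp M;
     eta_nu := W_eta cp M; mu_nu := W_mu cp M |}.

Definition is_T_derivation (C : CodifferentialCategory)
    (cp : FiniteCoproducts C) (A : TAlgebra (@codiff_T C))
    (M : Module (assoc_alg A)) (D : A ~> M) : Prop :=
  is_talg_hom (A := A) (B := W cp M) (pairb cp (idm A) D).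

Definition is_universal_T_derivation (C : CodifferentialCategory)
    (cp : FiniteCoproducts C) (A : TAlgebra (@codiff_T C))
    (U : Module (assoc_alg A)) (d : A ~> U) : Prop :=
  is_T_derivation cp d /\
  forall (M : Module (assoc_alg A)) (D : A ~> M), is_T_derivation cp D ->
    exists! h : U ~> M, is_linear h /\ d ;; h = D.

(* Main.v *)
From mathcomp Require Import ssreflect ssrfun.
Require Import Defs.

Local Open Scope cat_scope.

(** A map [D] is a [T]-derivation exactly when it satisfies the chain rule
    [nu; D = d; (nu ⊗ D); act].  For [D = d] on the free algebra this is (d4).
    A linear map out of the free module [TX ⊗ X] is determined by its
    precomposite with [eta; d = e ⊗ 1], which forces the factorization of [D] to
    be [(1 ⊗ (eta; D)); act]; precomposing the chain rule for [D] with [T eta]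
    shows that this map works. *)

Lemma T_derivationP (C : CodifferentialCategory) (cp : FiniteCoproducts C)
    (A : TAlgebra (@codiff_T C)) (M : Module (assoc_alg A)) (D : A ~> M) :
  is_T_derivation cp D <-> nu A ;; D = 𝐝 A ;; (nu A ⊠ D) ;; act M.
Proof.
have e1 : mon_map 𝐓 (pairb cp (idm A) D) ;; W_beta1 cp M = nu A.
  by rewrite /W_beta1 compA -mon_comp pair_proj1 mon_id comp1m.
have e2 : mon_map 𝐓 (pairb cp (idm A) D) ;; W_beta2 cp M
          = 𝐝 A ;; (nu A ⊠ D) ;; act M.
  (* Naturality of [𝐝] at the pairing moves it past [𝐝], where its components become [nu A] and
     [D]. *)
  rewrite W_beta2E !compA -deriv_nat -(compA (𝐝 A)) -tens_comp e1.
  by rewrite pair_proj2.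
rewrite /is_T_derivation /is_talg_hom /= /W_beta -e2; split=> [h | h].
- move: (f_equal (fun f => f ;; proj2b cp A M) h).
  by rewrite -!compA !pair_proj2.
(* The first components agree for every [D]: both are [nu A], by [e1]. *)
- apply: pair_eq; rewrite -!compA ?pair_proj1 ?pair_proj2 //.
  by rewrite e1 compm1.
Qed.

Lemma deriv_is_T_derivation (C : CodifferentialCategory)
    (cp : FiniteCoproducts C) (X : C) :
  is_T_derivation (A := free_talg codiff_T X) cp
    (M := free_module codiff_T X) (𝐝 X).
Proof. by apply/T_derivationP; rewrite /= /free_act deriv_mu !compA. Qed.

Definition free_ext (C : SymMonCategory) (T : AlgebraModality C) (X : C)
    (M : Module (assoc_alg (free_talg T X))) (f : X ~> M) : T X ⊗ X ~> M :=
  (idm (T X) ⊠ f) ;; act M.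

Arguments free_ext {C T X M} f.

(** Associativity of the action of [M] turns two successive actions into one action of a product,
    and the product in the associated algebra of [T X] is [mmul]. *)
Lemma free_ext_linear (C : SymMonCategory) (T : AlgebraModality C) (X : C)
    (M : Module (assoc_alg (free_talg T X))) (f : X ~> M) :
  is_linear (M := free_module T X) (free_ext f).
Proof.
have /= aM := actA M; rewrite free_assoc_mul in aM.
have actV : (idm (T X) ⊠ act M) ;; act M
            = assoV (T X) (T X) M ;; (mmul T X ⊠ idm M) ;; act M.
  by rewrite -(compA (assoV _ _ _)) -aM !compA assoVK comp1m.
rewrite /is_linear /free_ext /= /free_act.
rewrite -{2}[idm (T X)]comp1m tens_comp -(compA _ (idm _ ⊠ act M)) actV.
rewrite !compA assoV_nat -(compA _ (_ ⊠ _) (_ ⊠ _)) -tens_comp comp1m compm1.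
rewrite -(compA _ (_ ⊠ f) (_ ⊠ _)) -tens_comp compm1.
by rewrite tens_id comp1m.
Qed.

(** Generators [e ⊗ 1] span the free module: this is the right unit law of [mmul] combined with the
    triangle axiom. *)
Lemma free_act_unit (C : SymMonCategory) (T : AlgebraModality C) (X : C) :
  (idm (T X) ⊠ (lunitV X ;; (mone T X ⊠ idm X))) ;; free_act T X
  = idm (T X ⊗ X).
Proof.
rewrite /free_act -{1}[idm (T X)]comp1m tens_comp compA.
rewrite -(compA (_ ⊠ lunitV X)) assoV_nat -!compA -tens_comp.
rewrite (alg1r (modality_alg T X)) comp1m -triangle (compA (assoV _ _ _)).
by rewrite assoVK comp1m -tens_comp lunitVK comp1m tens_id.
Qed.

Lemma linear_free_ext (C : CodifferentialCategory) (X : C)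
    (M : Module (assoc_alg (free_talg (@codiff_T C) X)))
    (h : 𝐓 X ⊗ X ~> M) :
  is_linear (M := free_module codiff_T X) h ->
  h = free_ext (eta 𝐓 X ;; 𝐝 X ;; h).
Proof.
(* By (d3) the generators are [eta; 𝐝]; linearity then carries [h] inside the action. *)
rewrite /is_linear /= => hl; rewrite -[LHS]comp1m -free_act_unit -(deriv_eta 𝐝).
by rewrite -compA hl compA -tens_comp comp1m.
Qed.

Lemma T_derivation_factor (C : CodifferentialCategory)
    (cp : FiniteCoproducts C) (X : C)
    (M : Module (assoc_alg (free_talg (@codiff_T C) X))) (D : 𝐓 X ~> M) :
  is_T_derivation (A := free_talg codiff_T X) cp D ->
  𝐝 X ;; free_ext (eta 𝐓 X ;; D) = D.
Proof.
move=> /T_derivationP /= chain; rewrite -[RHS]comp1m -map_eta_mu -compA chain.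
(* Naturality of [𝐝] at [eta] brings [T eta] next to [mu], where the two cancel, and [eta] next to
   [D]. *)
rewrite /free_ext !compA -deriv_nat -(compA _ (_ ⊠ _) (_ ⊠ _)) -tens_comp.
by rewrite map_eta_mu.
Qed.

Theorem theorem4p15 (C : CodifferentialCategory) (cp : FiniteCoproducts C)
    (X : C) :
  is_universal_T_derivation (A := free_talg codiff_T X) cp
    (U := free_module codiff_T X) (codiff_d X).
Proof.
split; first exact: deriv_is_T_derivation.
move=> M D derD; exists (free_ext (eta 𝐓 X ;; D)); split.
- by split; [exact: free_ext_linear | exact: T_derivation_factor derD].
- by move=> h [/linear_free_ext hE <-]; rewrite compA -hE.
Qed.
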